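(* Let $\{u^n\}_{n\ge 0}$ be a sequence generated by the forward-backward splitting iteration described in the context, and assume that $F+\Phi$ is coercive or that the sequence $\{u^n\}$ is bounded. Then the functional values $(F+\Phi)(u^n)$ converge to the minimum of $F+\Phi$ with rate $$ r_n := (F+\Phi)(u^n) - \min_{u\in X}(F+\Phi)(u) \;\le\; C\, n^{1-p} \qquad \text{for all } n\ge 1, $$ for some constant $C>0$ independent of $n$.
   Context: Setting. $X$ is a real reflexive Banach space with dual $X^*$ and duality pairing $\langle\cdot,\cdot\rangle$. $F:X\to\mathbb{R}$ and $\Phi:X\to\mathbb{R}\cup\{\infty\}$ are proper, convex and lower semi-continuous. $F$ is differentiable and, for some fixed $1<p\le 2$, its derivative $F':X\to X^*$ is $(p-1)$-Hölder-continuous on each bounded set: for each $R>0$ there is $L>0$ with $\|F'(u)-F'(v)\|_{X^*}\le L\|u-v\|_X^{p-1}$ whenever $\|u\|_X,\|v\|_X\le R$. $F+\Phi$ is coercive, i.e. $(F+\Phi)(u)\to\infty$ as $\|u\|_X\to\infty$; in the alternative case where only boundedness of $\{u^n\}$ is assumed instead, it is understood that $F+\Phi$ possesses a minimizer. Iteration. Fix $0<\delta<1$ and $\underline\tau>0$, and start with $u^0\in X$, $\Phi(u^0)<\infty$. Given $u^n$, let $L_n>0$ (denoted $\|F'\|_{p-1}$) be a $(p-1)$-Hölder constant of $F'$ on a ball $\{\|u\|_X\le C_n\}$ such that $\|u\|_X\le C_n$ for all $u$ with $(F+\Phi)(u)\le(F+\Phi)(u^n)$ (one may keep $L_{n}=L_{n-1}$;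 in the non-coercive alternative, the $L_n$ are Hölder constants of $F'$ on a ball containing all iterates). Set $w^n=F'(u^n)$, choose $\tau_n$ with $0<\underline\tau\le\tau_n\le p(1-\delta)/L_n$, and let $u^{n+1}$ be a solution of $$\min_{v\in X}\ \frac{\|v-u^n\|_X^p}{p}+\tau_n\bigl(\langle w^n,v\rangle+\Phi(v)\bigr)$$ which minimizes $\|v-u^n\|_X$ among all solutions $v$. (Stopping at an optimal iterate corresponds to the sequence staying constant from then on.) *)

(* Defs.v *)
From HB Require Import structures.
From mathcomp Require Import all_boot all_order all_algebra.
From mathcomp Require Import all_classical all_reals all_analysis.

Set Implicit Arguments.
Unset Strict Implicit.
Unset Printing Implicit Defensive.

Import Order.TTheory GRing.Theory Num.Theory.
Import numFieldNormedType.Exports.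

Local Open Scope classical_set_scope.
Local Open Scope ring_scope.
Local Open Scope convex_scope.

Section Dual.
Context {R : realType} {X : normedModType R}.

(* The dual space X^* as a linear subspace of X -> R; the duality pairing of
   f and x is the application f x. *)
Definition topological_dual : set (X -> R^o) :=
  [set f | linear f /\ continuous f].

(* The operator norm. The set under the supremum is bounded above as soon as f
   is linear and continuous. *)
Definition dual_norm (f : X -> R^o) : R :=
  sup [set `|f x| | x in [set x : X | `|x| <= 1]].

End Dual.

(* The canonical embedding of X into its bidual is onto. An element of the
   bidual is a functional xi of which only the restriction to X^* matters,
   linear on X^* and bounded for the dual norm. *)
Definition reflexive_space (R : realType) (X : normedModType R) : Prop :=
  forall xi : (X -> R^o) -> R,
    (forall (a : R) (f g : X -> R^o),
      topological_dual f -> topological_dual g -> xi (a *: f + g) = a * xi f + xi g) ->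
    (exists M : R, forall f, topological_dual f ->
      `|xi f| <= M * dual_norm f) ->
  exists x : X, forall f, topological_dual f -> xi f = f x.

Section ConvexAnalysis.
Context {R : realType} {X : normedModType R}.
Implicit Types (Phi E : X -> \bar R) (F : X -> R^o) (p q r L tau : R).

Definition proper_efunction Phi : Prop :=
  (forall x, (-oo < Phi x)%E) /\ (exists x, (Phi x < +oo)%E).

(* Extended-real-valued counterpart of convex_function; recall 0 * +oo = 0. *)
Definition convex_efunction (Phi : convex_lmodType X -> \bar R) : Prop :=
  forall (t : {i01 R}) (x y : convex_lmodType X),
    (Phi (x <| t |> y) <= t%:num%:E * Phi x + (1 - t%:num)%:E * Phi y)%E.

Definition coercive E : Prop :=
  forall A : R, exists B : R, forall x : X, B <= `|x| -> (A%:E <= E x)%E.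

Definition minimizer E (x : X) : Prop := forall y : X, (E x <= E y)%E.

Definition energy F Phi (x : X) : \bar R := ((F x)%:E + Phi x)%E.

(* L is a q-Hoelder constant of the derivative F' : X -> X^* on the closed ball
   of center 0 and radius r. *)
Definition holder_diff_ball F q r L : Prop :=
  forall x y : X, `|x| <= r -> `|y| <= r ->
    dual_norm (fun v => 'd F x v - 'd F y v) <= L * `|x - y| `^ q.

Definition fb_objective F Phi p tau (x v : X) : \bar R :=
  ((`|v - x| `^ p / p)%:E + tau%:E * (('d F x v)%:E + Phi v))%E.

Definition fb_step F Phi p tau (x x' : X) : Prop :=
  minimizer (fb_objective F Phi p tau x) x' /\
  (forall v, minimizer (fb_objective F Phi p tau x) v ->
     `|x' - x| <= `|v - x|).

End ConvexAnalysis.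

(* Main.v *)
(** If [x'] is a forward-backward step from [x], let
    [D = <F'(x), x - x'> + Phi x - Phi x'].  Comparing [x'] with the points of
    the segment from [x'] to [x] gives [|x' - x|^p <= tau D], so the Hoelder
    estimate [F x' <= F x + <F'(x), x' - x> + L |x' - x|^p / p] yields
    [E x' <= E x - delta D] for the energy [E = F + Phi].  Comparing [x'] with
    [x + s (umin - x)] instead gives [D >= s (E x - min E) - s^p K] for [s]
    between 0 and 1, with [K] uniform in [x] because the iterates are bounded.
    Optimizing in [s] turns this into [r_(n+1) <= r_n - k r_n^(p / (p - 1))],
    which forces [r_n = O(n^(1 - p))].

    In the coercive case a minimizer exists by reflexivity: along an ultrafilter
    containing all nonempty sublevel sets, [f |-> lim f] is a bounded functional
    on the dual, and the point representing it lies in every sublevel set by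
    strict separation of a point from a closed convex set. *)

Require Import Defs.
From HB Require Import structures.
From mathcomp Require Import all_boot all_order all_algebra.
From mathcomp Require Import ring lra.
From mathcomp Require Import all_classical all_reals all_analysis.

Set Implicit Arguments.
Unset Strict Implicit.
Unset Printing Implicit Defensive.

Import Order.TTheory GRing.Theory Num.Theory.
Import numFieldNormedType.Exports.

Local Open Scope classical_set_scope.
Local Open Scope ring_scope.

(** * Hahn-Banach separation *)

Section InfLemmas.
Context {R : realType}.
Implicit Types A B C : set R.

Lemma inf_leD A B C : A !=set0 -> B !=set0 -> has_lbound C ->
  (forall a b, A a -> B b -> exists2 c, C c & c <= a + b) ->
  inf C <= inf A + inf B.
Proof.
move=> A0 B0 Clb ABC; rewrite -lerBlDl; apply: lb_le_inf => // b Bb.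
rewrite lerBlDl -lerBlDr; apply: lb_le_inf => // a Aa.
rewrite lerBlDr; have [c Cc] := ABC _ _ Aa Bb.
by apply: le_trans; apply: ge_inf.
Qed.

Lemma inf_leM k A C : 0 < k -> A !=set0 -> has_lbound C ->
  (forall a, A a -> exists2 c, C c & c <= k * a) ->
  inf C <= k * inf A.
Proof.
move=> k0 A0 Clb AC; rewrite -ler_pdivrMl//; apply: lb_le_inf => // a Aa.
rewrite ler_pdivrMl//; have [c Cc] := AC _ Aa.
by apply: le_trans; apply: ge_inf.
Qed.

End InfLemmas.

Section HahnBanach.
Context {R : realType} {V : lmodType R}.
Implicit Types (q : V -> R).

(** Homogeneity is asked as an inequality, which passes directly to infima; applying it to [a] and
    to its inverse gives equality. *)
Definition sublinear q :=
  (forall x y, q (x + y) <= q x + q y) /\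
  (forall a x, 0 < a -> q (a *: x) <= a * q x).

Lemma sublinearZ q a x : sublinear q -> 0 < a -> q (a *: x) = a * q x.
Proof.
move=> [_ qZ] a0; apply/eqP; rewrite eq_le qZ//= -ler_pdivlMl//.
by rewrite -{1}[x](scalerK (lt0r_neq0 a0)) qZ// invr_gt0.
Qed.

Lemma sublinear0 q : sublinear q -> q 0 = 0.
Proof.
move=> sq; have := sublinearZ 0 sq (ltr0n _ 2); rewrite scaler0; lra.
Qed.

Lemma sublinear_geN q x : sublinear q -> - q (- x) <= q x.
Proof.
move=> sq; have := sq.1 x (- x); rewrite subrr sublinear0//; lra.
Qed.

(** Zorn's lemma applies because the pointwise infimum of a chain is again sublinear; it is finite
    since [m <= q] gives [- q (- x) <= - m (- x) <= m x]. *)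
Lemma minimal_sublinear q : sublinear q ->
  exists m, [/\ sublinear m, forall x, m x <= q x &
    forall m', sublinear m' -> (forall x, m' x <= m x) -> m' = m].
Proof.
move=> sq.
pose T := {m | sublinear m /\ forall x, m x <= q x}.
pose mk m sm mq : {classic T} := exist _ m (conj sm mq).
(* The order is reversed, so that a maximal element is a pointwise minimal functional. *)
pose le (m m' : {classic T}) := `[< forall x, sval m' x <= sval m x >].
have [||A Atot|[m [sm mq]] mmin] := @ZL_preorder {classic T}
    (mk q sq (fun x => lexx _)) le.
- by move=> m; apply/asboolP.
- move=> m1 m2 m3 /asboolP m12 /asboolP m23; apply/asboolP => x.
  exact: le_trans (m12 x).
- have [[m0 Am0]|A0] := pselect (A !=set0); last first.
    by exists (mk q sq (fun x => lexx _)) => m Am; case: A0; exists m.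
  pose S x := [set sval m x | m in A].
  have S0 x : S x !=set0 by exists (sval m0 x), m0.
  have Slb x : has_lbound (S x).
    exists (- q (- x)) => _ [[m /= [sm mq]] _ <-] /=.
    by apply: le_trans (sublinear_geN _ sm); rewrite lerN2.
  have sinf : sublinear (fun x => inf (S x)).
    split=> [x y|a x a0].
      apply: inf_leD => // _ _ [m Am <-] [m' Am' <-].
      (* Of two functionals in the chain, the smaller one bounds both summands at once. *)
      have [/asboolP mm'|/asboolP mm'] := Atot _ _ Am Am'.
      - exists (sval m' (x + y)); first by exists m'.
        by apply: le_trans ((svalP m').1.1 _ _) _; rewrite lerD2r.
      - exists (sval m (x + y)); first by exists m.
        by apply: le_trans ((svalP m).1.1 _ _) _; rewrite lerD2l.
    apply: inf_leM => // _ [m Am <-];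
    exists (sval m (a *: x)); first by exists m.
    exact: (svalP m).1.2.
  have infq x : inf (S x) <= q x.
    by apply: le_trans ((svalP m0).2 x); apply: ge_inf => //; exists m0.
  exists (mk _ sinf infq) => m Am; apply/asboolP => x /=.
  by apply: ge_inf => //; exists m.
exists m; split => // m' sm' m'm.
have m'q x : m' x <= q x by apply: le_trans (mq x).
have /asboolP mm' := mmin (mk m' sm' m'q) (introT (asboolP _) m'm).
by apply/funext => x; apply/eqP; rewrite eq_le m'm/=; exact: mm'.
Qed.

(* Minimality is tested against [y |-> inf_(t >= 0) (m (y + t x) - t m x)],
   which is at most [- m x] at [- x]. *)
Lemma minimal_sublinearN m x : sublinear m ->
  (forall m', sublinear m' -> (forall y, m' y <= m y) -> m' = m) ->
  m (- x) = - m x.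
Proof.
move=> sm mmin.
pose S (y : V) := [set m (y + t *: x) - t * m x | t in [set t | 0 <= t]].
have S0 y : S y !=set0 by exists (m (y + 0 *: x) - 0 * m x), 0 => /=.
have Slb y : has_lbound (S y).
  exists (- m (- y)) => _ [t /= t0 <-].
  have -> : t * m x = m (t *: x).
    move: t0; rewrite le_eqVlt => /predU1P[<-|t0].
      by rewrite scale0r mul0r sublinear0.
    by rewrite sublinearZ.
  have := sm.1 (- y) (y + t *: x); rewrite addKr; lra.
have Sm y : inf (S y) <= m y.
  apply: ge_inf => //; exists 0 => /=; first exact: lexx.
  by rewrite scale0r mul0r addr0 subr0.
have sS : sublinear (fun y => inf (S y)).
  split=> [y z|a y a0].
    apply: inf_leD => // _ _ [t /= t0 <-] [s /= s0 <-].
    exists (m (y + z + (t + s) *: x) - (t + s) * m x).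
      by exists (t + s) => //=; exact: addr_ge0.
    have := sm.1 (y + t *: x) (z + s *: x).
    by rewrite addrACA -scalerDl; lra.
  apply: inf_leM => // _ [t /= t0 <-].
  exists (m (a *: y + (a * t) *: x) - a * t * m x).
    by exists (a * t) => //=; rewrite mulr_ge0// ltW.
  rewrite -scalerA -scalerDr mulrBr mulrA lerD2r; exact: sm.2.
have mE := mmin _ sS Sm.
apply/eqP; rewrite eq_le; apply/andP; split; last first.
  by rewrite lerNl; exact: sublinear_geN.
have -> : m (- x) = inf (S (- x)) by rewrite -[in LHS]mE.
apply: ge_inf => //; exists 1 => //=.
by rewrite scale1r addNr mul1r sublinear0// sub0r.
Qed.

(** A minimal sublinear functional below [q] is odd, and oddness turns subadditivity into additivity
    and extends homogeneity to negative scalars. *)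
Theorem sublinear_ge_linear q : sublinear q ->
  exists f : V -> R^o, linear f /\ forall x, f x <= q x.
Proof.
move=> /minimal_sublinear[m [sm mq mmin]]; exists m; split=> // a x y.
have mN z : m (- z) = - m z by exact: minimal_sublinearN.
have mD z w : m (z + w) = m z + m w.
  apply/eqP; rewrite eq_le sm.1/=.
  by rewrite -[z + w]opprK mN lerNr [leRHS]opprD -!mN opprD; exact: sm.1.
rewrite mD; congr (_ + _); rewrite -[RHS]/(a * m x).
have [a0|a0|->] := ltgtP a 0; last by rewrite scale0r mul0r sublinear0.
- by rewrite -[a]opprK scaleNr mN sublinearZ ?oppr_gt0// !mulNr.
- exact: sublinearZ.
Qed.

End HahnBanach.

(** * Continuous linear functionals and strict separation *)

Section DualSpace.
Local Open Scope convex_scope.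
Context {R : realType} {X : normedModType R}.
Implicit Types (f : X -> R^o).

Lemma bounded_topological_dual f M : linear f ->
  (forall x, `|f x| <= M * `|x|) -> topological_dual f.
Proof.
move=> flin fM; split=> //.
pose fL : {linear X -> R^o} := HB.pack f (GRing.isLinear.Build _ _ _ _ f flin).
apply: (@bounded_linear_continuous _ _ _ fL).
apply/linear_boundedP; near=> r => x.
apply: le_trans (fM x) _; rewrite ler_wpM2r//; near: r; exact: nbhs_pinfty_ge.
Unshelve. all: by end_near. Qed.

Lemma topological_dual_bounded f : topological_dual f ->
  exists2 M, 0 < M & forall x, `|f x| <= M * `|x|.
Proof.
move=> [flin fcont].
pose fL : {linear X -> R^o} := HB.pack f (GRing.isLinear.Build _ _ _ _ f flin).
have := (@linear_bounded_continuous _ _ _ fL).2 fcont.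
move=> /linear_boundedP /pinfty_ex_gt0[M M0 fM]; exists M => // x; exact: fM.
Qed.

Lemma dual_norm_le f x : topological_dual f -> `|f x| <= dual_norm f * `|x|.
Proof.
move=> df; have [M M0 fM] := topological_dual_bounded df.
have fZ a y : f (a *: y) = a * f y.
  have f0 : f 0 = 0.
    by have := fM 0; rewrite normr0 mulr0 normr_le0 => /eqP.
  by have := df.1 a y 0; rewrite f0 !addr0.
have [->|x0] := eqVneq x 0.
  by have := fM 0; rewrite normr0 !mulr0.
have nx0 : 0 < `|x| by rewrite normr_gt0.
rewrite -ler_pdivrMr//; apply: ub_le_sup.
  exists M => _ [y /= y1 <-]; apply: le_trans (fM y) _.
  by rewrite ger_pMr.
exists (`|x|^-1 *: x) => /=.
  by rewrite normrZ normfV normr_id mulVf// gt_eqF.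
by rewrite fZ normrM normfV normr_id mulrC.
Qed.

(* [f] is a linear minorant of the sublinear functional
   [y |-> inf (`|y + t (c - x0)| - t e)], over [t >= 0] and [c] in [C], where
   [e] bounds from below the distance from [x0] to [C]; taking [y = x0 - c]
   and [t = 1] separates. *)
Theorem strict_separation (C : set X) (x0 : X) :
  C !=set0 -> closed C -> convex_set C -> ~ C x0 ->
  exists f, topological_dual f /\
    exists2 e, 0 < e & forall c, C c -> f x0 + e <= f c.
Proof.
move=> [c0 Cc0] Ccl Ccvx Cx0.
have [e e0 Ce] : exists2 e, 0 < e & forall c, C c -> e <= `|c - x0|.
  have : nbhs x0 (~` C).
    by apply: open_nbhs_nbhs; split=> //; exact: closed_openC.
  move=> /nbhs_normP[e /= e0 eC]; exists e => // c Cc.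
  by rewrite leNgt; apply/negP => ce; apply: (eC c) => //=; rewrite distrC.
pose S y := [set z | exists t c, [/\ 0 <= t, C c &
  z = `|y + t *: (c - x0)| - t * e]].
have Sm y t c : 0 <= t -> C c -> S y (`|y + t *: (c - x0)| - t * e).
  by move=> t0 Cc; exists t, c.
have S0 y : S y !=set0 by eexists; exact: (Sm y 0 c0).
have Slb y : has_lbound (S y).
  exists (- `|y|) => _ [t [c [t0 Cc ->]]].
  have : t * e <= `|t *: (c - x0)|.
    by rewrite normrZ (ger0_norm t0) ler_wpM2l// Ce.
  have := ler_normB (y + t *: (c - x0)) y.
  rewrite [y + _ - y]addrAC subrr add0r; lra.
have sS : sublinear (fun y => inf (S y)).
  split=> [y z|a y a0].
    apply: inf_leD => // _ _ [t [c [t0 Cc ->]]] [s [d [s0 Cd ->]]].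
    (* The sum [t (c - x0) + s (d - x0)] is [t + s] times a convex combination of [c] and [d], minus
       [x0]. The weights make no sense when [t + s = 0], where only the triangle inequality
       remains. *)
    have [ts0|ts0] := eqVneq (t + s) 0.
      have [tz sz] : t = 0 /\ s = 0 by split; lra.
      exists (`|(y + z) + 0 *: (c0 - x0)| - 0 * e); first exact: Sm.
      rewrite tz sz !scale0r !addr0 mul0r !subr0; exact: ler_normD.
    have ts : 0 < t + s by rewrite lt_neqAle eq_sym ts0 addr_ge0.
    have l0 : 0 <= t / (t + s) by rewrite divr_ge0// ltW.
    have l1 : t / (t + s) <= 1 by rewrite ler_pdivrMr// mul1r lerDl.
    have /set_mem Cm := Ccvx c d (Itv01 l0 l1) (mem_set Cc) (mem_set Cd).
    eexists; first exact: (Sm _ (t + s) _ (ltW ts) Cm).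
    have := ler_normD (y + t *: (c - x0)) (z + s *: (d - x0)).
    suff -> : y + t *: (c - x0) + (z + s *: (d - x0)) =
      y + z +
      (t + s) *: ((c : convex_lmodType X) <| Itv01 l0 l1 |> d - x0) by lra.
    rewrite addrACA; congr (_ + _).
    have -> : (c : convex_lmodType X) <| Itv01 l0 l1 |> d =
      t / (t + s) *: c + (1 - t / (t + s)) *: d by [].
    rewrite !scalerBr !scalerDr !scalerA.
    rewrite mulrBr mulr1 mulrCA divff// mulr1 [t + s - t]addrAC subrr add0r.
    by rewrite scalerDl opprD addrACA.
  apply: inf_leM => // _ [t [c [t0 Cc ->]]].
  exists (`|a *: y + (a * t) *: (c - x0)| - a * t * e).
    by apply: Sm => //; rewrite mulr_ge0// ltW.
  by rewrite -scalerA -scalerDr normrZ gtr0_norm// mulrBr mulrA.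
have [f [flin fS]] := sublinear_ge_linear sS.
have fD : {morph f : y z / y - z}.
  by move=> y z; have := flin (-1) z y; rewrite !scaleN1r ![- _ + _]addrC.
have f_le y t c : 0 <= t -> C c -> f y <= `|y + t *: (c - x0)| - t * e.
  by move=> t0 Cc; apply: le_trans (fS y) _; apply: ge_inf => //; exact: Sm.
exists f; split.
  apply: (@bounded_topological_dual _ 1) => // y; rewrite mul1r ler_norml.
  (* The choice [t = 0] bounds [f] by the norm, which makes it continuous. *)
  have h z : f z <= `|z|.
    by have := f_le z 0 c0 (lexx _) Cc0; rewrite scale0r addr0 mul0r subr0.
  have := h (- y).
  rewrite normrN -[- y]sub0r fD -[X in f X - _](subrr 0) fD subrr sub0r.
  by have := h y; lra.
exists e => // c Cc; have := f_le (x0 - c) 1 c ler01 Cc.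
rewrite scale1r addrA subrK subrr normr0 mul1r sub0r fD; lra.
Qed.

End DualSpace.

(** * Reflexivity and existence of minimizers *)

Lemma ultra_image_filter (T U : Type) (g : T -> U) (G : set_system T) :
  UltraFilter G -> UltraFilter (g @ G).
Proof.
move=> GU; split; first exact: fmap_proper_filter.
move=> H HF GH; apply/seteqP; split=> // A HA.
have [//|GnA] := in_ultra_setVsetC (g @^-1` A) GU.
have /(filterI HA) : H (~` A) by exact: GH.
by rewrite setICr => /filter_not_empty.
Qed.

Lemma ultra_bounded_cvg (R : realType) (T : Type) (G : set_system T)
    (g : T -> R) (K : R) : UltraFilter G -> G [set t | `|g t| <= K] ->
  cvg (g @ G).
Proof.
move=> GU GK; have := @segment_compact R (- K) K; rewrite compact_ultra.
have gK : G (g @^-1` `[- K, K]).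
  by apply: filterS GK => t /= gtK; rewrite in_itv/= -ler_norml.
move=> /(_ _ (ultra_image_filter g GU) gK)[l [_ gl]].
by apply/cvg_ex; exists l.
Qed.

(** Weak compactness of balls in ultrafilter form. Each [f] is bounded on a member of [G], so it
    converges along [G] by compactness of segments, and reflexivity represents the limit functional
    by a point. *)
Theorem reflexive_ultra_weak_cvg (R : realType) (X : normedModType R)
    (G : set_system X) (M : R) :
  reflexive_space X -> UltraFilter G -> G [set x | `|x| <= M] ->
  exists x, forall f : X -> R^o, topological_dual f -> f y @[y --> G] --> f x.
Proof.
move=> Xr GU GM.
have fcvg (f : X -> R^o) : topological_dual f -> cvg (f @ G).
  move=> df; have [N N0 fN] := topological_dual_bounded df.
  apply: (@ultra_bounded_cvg _ _ _ _ (N * M)); apply: filterS GM => y /= yM.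
  by apply: le_trans (fN y) _; rewrite ler_pM2l.
have [||x xE] := Xr (fun f => lim (f @ G)).
- move=> a f g df dg; apply/cvg_lim => //.
  apply: cvgD; last exact: fcvg.
  by apply: cvgZr; exact: fcvg.
- exists M => f df; rewrite -lim_norm; last exact: fcvg.
  apply: limr_le; first by apply: is_cvg_norm; exact: fcvg.
  apply: filterS GM => y /= yM; apply: le_trans (dual_norm_le y df) _.
  rewrite mulrC ler_wpM2r//; apply: ub_le_sup => //.
    have [N N0 fN] := topological_dual_bounded df.
    exists N => _ [z /= z1 <-]; apply: le_trans (fN z) _.
    by rewrite ger_pMr.
  exists 0; rewrite /= ?normr0//.
  have [N N0 fN] := topological_dual_bounded df.
  by have := fN 0; rewrite normr0 mulr0 normr_le0 => /eqP ->; rewrite normr0.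
by exists x => f df; rewrite -xE//; exact: fcvg.
Qed.

Section Minimizers.
Local Open Scope convex_scope.
Context {R : realType} {X : normedModType R}.
Implicit Types (E Phi : X -> \bar R) (F : X -> R^o) (a : R).

Lemma lsc_closed_sublevel E a : lower_semicontinuous E ->
  closed [set x | (E x <= a%:E)%E].
Proof.
move=> /lower_semicontinuousP/(_ a)/open_closedC.
by congr closed; apply/seteqP; split=> x /=; rewrite leNgt => /negP.
Qed.

Lemma convex_sublevel E a : convex_efunction E ->
  convex_set [set x | (E x <= a%:E)%E].
Proof.
move=> Ecvx x y t /set_mem/= xa /set_mem/= ya; apply/mem_set => /=.
apply: le_trans (Ecvx t x y) _.
have -> : a%:E = (t%:num%:E * a%:E + (1 - t%:num)%:E * a%:E)%E.
  by rewrite -!EFinM -EFinD; congr EFin; lra.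
apply: leeD; apply: lee_wpmul2l => //; rewrite lee_fin//.
Qed.

Theorem coercive_has_minimizer E : reflexive_space X ->
  (exists x, (E x < +oo)%E) -> convex_efunction E -> lower_semicontinuous E ->
  coercive E -> exists x, minimizer E x.
Proof.
move=> Xr [x0 Ex0] Ecvx Elsc Eco.
pose S a := [set x | (E x <= a%:E)%E].
pose D a := S a !=set0.
have D_ex x : (E x < +oo)%E -> exists2 a, D a & (E x = a%:E \/ E x = -oo%E).
  case Exa: (E x) => [a| |]// _; last first.
    by exists 0; [exists x; rewrite /S/= Exa leNye|right].
  by exists a; [exists x; rewrite /S/= Exa|left].
have [a0 Da0 _] := D_ex _ Ex0.
have SF : ProperFilter (filter_from D S).
  apply: filter_from_proper => //.
  apply: filter_from_filter; first by exists a0.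
  move=> a b Da Db; exists (Num.min a b).
    by rewrite /Num.min; case: ifP.
  by move=> x; rewrite /S/= EFin_min le_min => /andP[].
have [G [GU SG]] := ultraFilterLemma SF.
have GS a : D a -> G (S a) by move=> Da; apply: SG; exists a.
have [B EB] := Eco (a0 + 1).
have GB : G [set x | `|x| <= B].
  apply: filterS (GS _ Da0) => x /= xa; rewrite leNgt; apply/negP => /ltW/EB.
  by move=> /le_trans/(_ xa); rewrite lee_fin; lra.
have [x Gx] := reflexive_ultra_weak_cvg Xr GU GB.
have Sx a : D a -> S a x.
  move=> Da; apply: contrapT => Sax.
  have [f [df [e e0 fe]]] := strict_separation Da (lsc_closed_sublevel Elsc)
    (convex_sublevel Ecvx) Sax.
  have : f x + e <= f x.
    rewrite -[leRHS](cvg_lim _ (Gx _ df))//.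
    apply: limr_ge; first by apply/cvg_ex; exists (f x); exact: Gx.
    by apply: filterS (GS _ Da) => y /= /fe.
  by rewrite gerDl leNgt e0.
exists x => y; case Ey: (E y) => [a| |]; rewrite ?leey//.
  by apply: Sx; exists y; rewrite /S/= Ey.
(* If [E y = -oo], every real level has a nonempty sublevel set, so [x] lies in all of them and
   [E x] cannot be a real [a]. *)
rewrite leeNy_eq; case Ex: (E x) => [a| |]//.
  have : S (a - 1) x by apply: Sx; exists y; rewrite /S/= Ey leNye.
  by rewrite /S/= Ex lee_fin; lra.
by have := Sx _ Da0; rewrite /S/= Ex.
Qed.

Lemma energy_lsc F Phi : (forall x, (-oo < Phi x)%E) ->
  lower_semicontinuous (fun x : X => (F x)%:E) -> lower_semicontinuous Phi ->
  lower_semicontinuous (energy F Phi).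
Proof.
move=> PhiNy Flsc Philsc x a; rewrite /energy => ax.
(* Splitting the level as [(a - b) + b], each part strictly below its own summand, reduces the claim
   to the semicontinuity of [F] and of [Phi]. *)
have [b bF bPhi] : exists2 b, a - b < F x & (b%:E < Phi x)%E.
  have := PhiNy x; move: ax; case: (Phi x) => [r| |]//.
    rewrite -EFinD lte_fin => ax _.
    by exists ((a - F x + r) / 2); rewrite ?lte_fin; lra.
  by move=> _ _; exists (a - F x + 1); [lra|exact: ltry].
have [V Vx VF] := Flsc x (a - b) bF.
have [W Wx WPhi] := Philsc x b bPhi.
exists (V `&` W); first exact: filterI.
move=> y [/VF Vy /WPhi Wy].
have -> : a%:E = ((a - b)%:E + b%:E)%E by rewrite -EFinD subrK.
exact: lteD.
Qed.

Lemma energy_convex F Phi : convex_function setT F ->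
  convex_efunction Phi ->
  convex_efunction (energy F Phi).
Proof.
move=> Fcvx Phicvx t x y; rewrite /energy.
have Fxy : F ((x : convex_lmodType X) <| t |> y) <=
    t%:num * F x + (1 - t%:num) * F y.
  exact: (Fcvx t x y (in_setT _) (in_setT _)).
rewrite !muleDr ?fin_num_adde_defr// addeACA.
apply: leeD; last exact: Phicvx.
by rewrite -!EFinM -EFinD lee_fin.
Qed.

End Minimizers.

(** * The scalar recursion *)

Section Rate.
Context {R : realType}.
Implicit Types (p : R).

(** A Bernoulli-type bound: [(1 - s)^p = exp (p ln (1 - s)) <= exp (- p s) <= 1 / (1 + p s)]. *)
Lemma powR_onem_le p s : 0 <= p -> 0 <= s < 1 -> (1 - s) `^ p <= (1 + p * s)^-1.
Proof.
move=> p0 /andP[s0 s1].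
have ps : 0 < 1 + p * s by rewrite ltr_pwDl// mulr_ge0.
rewrite /powR gt_eqF ?subr_gt0//.
rewrite -[leLHS]invrK lef_pV2 ?posrE ?invr_gt0 ?expR_gt0//.
rewrite -expRN; apply: le_trans (expR_ge1Dx _) _; rewrite ler_expR.
by rewrite -mulrN ler_wpM2l// lerNr le_ln1Dx// ltrN2.
Qed.

(* With [w = c * r ^ (1 / (p - 1))] the recursion becomes [w' <= w * (1 - w)],
   which forces [n * w n <= 1]. *)
Lemma descent_rate p (delta K : R) (r A : nat -> R) : 1 < p -> p <= 2 ->
  0 < delta -> 0 < K -> (forall n, 0 <= r n) ->
  (forall n, r n.+1 <= r n - delta * A n) ->
  (forall n s, 0 <= s <= 1 -> s * r n - s `^ p * K <= A n) ->
  exists2 C, 0 < C & forall n, (1 <= n)%N -> r n <= C * n%:R `^ (1 - p).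
Proof.
move=> p1 p2 d0 K0 r0 rS rA.
have p10 : 0 < p - 1 by rewrite subr_gt0.
have A0 n : 0 <= A n.
  have := rA n 0.
  rewrite lexx ler01 powR0 ?gt_eqF ?(lt_trans _ p1)// !mul0r subr0.
  exact.
have rd n : r n <= r 0%N.
  elim: n => // n; apply: le_trans; apply: le_trans (rS n) _.
  by rewrite gerBl mulr_ge0// ltW.
pose z n := r n `^ (p - 1)^-1.
have z0 n : 0 <= z n by exact: powR_ge0.
have zr n : z n `^ (p - 1) = r n.
  by rewrite /z -powRrM mulVf ?gt_eqF// powRr1.
have zd n : z n <= z 0%N.
  by apply: ge0_ler_powR; rewrite ?nnegrE ?invr_ge0 ?(ltW p10) ?r0 ?rd.
(* The first entry makes [s = c * z n] admissible, that is, at most 1; the second makes the loss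
   [s^p K] at most half of the gain [s * r n]. *)
pose c := Num.min (1 + z 0%N)^-1 ((2 * K)^-1 `^ (p - 1)^-1).
have c0 : 0 < c.
  by rewrite lt_min invr_gt0 ltr_pwDl//= powR_gt0// invr_gt0 mulr_gt0.
have cz n : c * z n <= 1.
  have : c <= (1 + z 0%N)^-1 by rewrite ge_min lexx.
  move=> /(ler_wpM2r (z0 n))/le_trans; apply.
  rewrite ler_pdivrMl ?ltr_pwDl// mulr1.
  by apply: le_trans (zd n) _; rewrite lerDr.
have cK : c `^ (p - 1) * K <= 2^-1.
  have : c <= (2 * K)^-1 `^ (p - 1)^-1 by rewrite ge_min lexx orbT.
  move=> /(ge0_ler_powR (ltW p10)).
  rewrite !nnegrE powR_ge0 (ltW c0) -powRrM mulVf ?gt_eqF// powRr1; last first.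
    by rewrite invr_ge0 mulr_ge0// ltW.
  move=> /(_ isT isT); rewrite -(ler_pM2r K0) invfM -mulrA mulVf ?gt_eqF//.
  by rewrite mulr1.
have Az n : c / 2 * z n * r n <= A n.
  have := rA n (c * z n); rewrite mulr_ge0// ?(ltW c0)// cz => /(_ isT).
  apply: le_trans.
  have -> : (c * z n) `^ p = c * z n * (c `^ (p - 1) * r n).
    by rewrite -(mulr_powRB1 _ (lt_trans ltr01 p1)) ?mulr_ge0 ?(ltW c0)//
      powRM ?(ltW c0)// zr.
  have : c * z n * r n * (c `^ (p - 1) * K) <= c * z n * r n * 2^-1.
    by rewrite ler_wpM2l// !mulr_ge0// ltW.
  lra.
pose k := delta * (c / 2).
have k0 : 0 < k by rewrite mulr_gt0// divr_gt0.
have rz n : r n.+1 <= r n * (1 - k * z n).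
  apply: le_trans (rS n) _; have := Az n; rewrite -(ler_pM2l d0) /k; lra.
have zS n : z n.+1 <= z n * (1 - k * z n).
  (* A negative factor is compatible with [r n.+1 >= 0] only if [r n = 0], but then the factor is
     1. *)
  have [kz|kz] := leP 0 (1 - k * z n); last first.
    have r_eq0 : r n = 0.
      apply/eqP; rewrite eq_le r0 andbT leNgt; apply/negP => rn.
      by have := le_trans (r0 n.+1) (rz n); rewrite pmulr_rge0// leNgt kz.
    have zn : z n = 0 by rewrite /z r_eq0 powR0// invr_eq0 gt_eqF.
    by move: kz; rewrite zn mulr0 subr0 ltNge ler01.
  apply: (@le_trans _ _ ((r n * (1 - k * z n)) `^ (p - 1)^-1)).
    apply: ge0_ler_powR; rewrite ?invr_ge0 ?(ltW p10)// nnegrE ?r0//.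
    by rewrite mulr_ge0.
  rewrite powRM// ler_wpM2l ?powR_ge0//.
  (* Since [p <= 2], the exponent is at least 1, and raising a number of the unit interval to it
     does not increase it. *)
  have : 1 <= (p - 1)^-1 by rewrite invf_ge1//; lra.
  have kz1 : 1 - k * z n <= 1 by rewrite gerBl mulr_ge0// ltW.
  move: kz; rewrite le_eqVlt => /predU1P[<- _|kz p1'].
    by rewrite powR0// invr_eq0 gt_eqF.
  by apply: ge1r_powR => //; rewrite kz.
have nz n : n%:R * (k * z n) <= 1.
  elim: n => [|n IH]; first by rewrite mul0r.
  have : k * z n.+1 <= k * z n * (1 - k * z n).
    by rewrite -mulrA ler_pM2l.
  have := mulr_ge0 (ltW k0) (z0 n); have := mulr_ge0 (ltW k0) (z0 n.+1).
  rewrite -natr1; move: (k * z n.+1) (k * z n) IH => w' w.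
  have := ler0n R n; move: n%:R => m m0 IH w'0 w0 ww'.
  have w1 : w <= 1.
    rewrite leNgt; apply/negP => w1.
    have : w * (1 - w) < 0 by rewrite pmulr_rlt0 ?subr_lt0// (lt_trans ltr01).
    by rewrite ltNge (le_trans w'0 ww').
  (* With [m w <= 1] this gives [(m + 1) w' <= (1 - w) + w (1 - w) = 1 - w^2 <= 1]. *)
  have h1 : (m + 1) * w' <= (m + 1) * (w * (1 - w)).
    by rewrite ler_wpM2l// addr_ge0.
  have : m * w * (1 - w) <= 1 * (1 - w) by apply: ler_wpM2r; rewrite ?subr_ge0.
  have := mulr_ge0 w0 w0; move: h1; nra.
exists (k `^ (1 - p)); first exact: powR_gt0.
move=> n n1; have n0 : 0 < n%:R :> R by rewrite ltr0n.
have kn0 : 0 <= k * n%:R by rewrite mulr_ge0// ltW.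
rewrite -powRM ?(ltW k0)// -opprB powRN -powR_inv1 ?powR_ge0// powRAC.
rewrite powR_inv1// -zr; apply: ge0_ler_powR.
- exact: ltW.
- exact: z0.
- by rewrite nnegrE invr_ge0.
by rewrite -[leRHS]mul1r ler_pdivlMr ?mulr_gt0// mulrC -mulrA mulrCA nz.
Qed.
End Rate.

(** * One forward-backward step *)

Section DirectionalDerivative.
Context {R : realType} {X : normedModType R}.
Implicit Types (F : X -> R^o) (x h : X).

Lemma is_derive_line F x h t : differentiable F (x + t *: h) ->
  is_derive t 1 (fun s : R => F (x + s *: h) : R) ('d F (x + t *: h) h).
Proof.
move=> dF; have Fd := @diff_derivable _ _ _ _ _ h dF.
have FE := @deriveE _ _ _ _ _ h dF.
have e : (fun s : R => s^-1 *:
      (((fun u : R => F (x + u *: h) : R) \o shift t) (s *: 1)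
       - F (x + t *: h))) =
    (fun s : R => s^-1 *: ((F \o shift (x + t *: h)) (s *: h)
       - F (x + t *: h))).
  apply/funext => s /=; congr (_ *: (F _ - _)).
  by rewrite [s *: 1]mulr1 scalerDl addrCA.
by split; [rewrite /derivable|rewrite /derive]; rewrite e.
Qed.

Lemma exists_lt_diff F x h (c : R) : differentiable F x -> 'd F x h < c ->
  exists2 s, 0 < s < 1 & F (x + s *: h) - F x < s * c.
Proof.
move=> dF dc; have Fd := @diff_derivable _ _ _ _ _ h dF.
have := cvgr_lt _ Fd _; rewrite -[lim _]/('D_h F x) deriveE// => /(_ _ c dc).
move=> /nbhs_ballP[e /= e0 he].
pose s := Num.min e 1 / 2.
have [es es1] : s < e /\ s < 1.
  have := ge_min e e 1; have := ge_min 1 e 1; rewrite !lexx orbT /= /s.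
  have : 0 < Num.min e 1 by rewrite lt_min e0/=.
  lra.
have s0 : 0 < s by rewrite divr_gt0// lt_min e0/=.
exists s; first by rewrite s0.
have := he s; rewrite /ball/= sub0r normrN gtr0_norm// => /(_ es).
rewrite gt_eqF// => /(_ isT).
by rewrite -[_ *: _]/(s^-1 * _) ltr_pdivrMl//= [x + _]addrC.
Qed.

(** If the slope at [x] exceeded [F y - F x], then for some small [s] the graph of [F] would lie
    strictly above its chord at [x + s (y - x)]. The previous lemma supplies this [s] when applied
    to [- F]. *)
Lemma convex_gradient_le F x y : convex_function setT F -> differentiable F x ->
  'd F x (y - x) <= F y - F x.
Proof.
move=> Fcvx dF; rewrite leNgt; apply/negP => Fxy.
have [||s /andP[s0 s1]] := @exists_lt_diff (- F) x (y - x) (- (F y - F x)).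
- exact: differentiableN.
- have -> : 'd (- F) x (y - x) = - 'd F x (y - x) by rewrite diffN.
  by rewrite ltrN2.
have sl : s <= 1 by exact: ltW.
have := Fcvx (Itv01 (ltW s0) sl) y x (in_setT _) (in_setT _).
rewrite -[X in F X <= _]/(s *: y + (1 - s) *: x).
rewrite -[X in _ <= X]/(s * F y + (1 - s) * F x).
have -> : s *: y + (1 - s) *: x = x + s *: (y - x).
  by rewrite scalerBl scale1r scalerBr addrCA.
rewrite -[(- F) _]/(- F _) -[(- F) x]/(- F x); lra.
Qed.

End DirectionalDerivative.

(** * The descent estimate from a Hoelder continuous derivative *)

Section HoelderDescent.
Context {R : realType}.

(** Subtracting the primitive [c t + K / p * t^p] of the bound leaves a function with nonpositive
    derivative on the open unit interval, and the mean value theorem concludes without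
    integration. *)
Lemma derive_powR_bound (g dg : R -> R) (p c K : R) : 1 < p ->
  (forall t : R, is_derive t 1 g (dg t)) ->
  (forall t : R, 0 < t < 1 -> dg t <= c + K * t `^ (p - 1)) ->
  g 1 - g 0 <= c + K / p.
Proof.
move=> p1 gd dgle.
have p0 : 0 < p by apply: lt_trans p1.
pose k (t : R) := g t - (c * t + K / p * t `^ p).
have kd (t : R) : t \in `]0, 1[ ->
    is_derive t 1 k (dg t - (c + K * t `^ (p - 1))).
  rewrite in_itv/= => /andP[t0 t1].
  have gt := gd t; have pt := is_derive1_powR p t0.
  apply: is_derive_eq.
  rewrite /GRing.scale/= mulr1 mulrA divfK ?gt_eqF//.
have gc (t : R) : {for t, continuous g}.
  by apply: differentiable_continuous; apply/derivable1_diffP; apply: ex_derive.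
(* The derivative formula for the power covers only [t > 0], so the endpoint 0 needs a one-sided
   limit. *)
have powRc : (fun t : R => t `^ p) @ 0^'+ --> 0 `^ p.
  by rewrite powR0 ?gt_eqF//; exact: powR_cvg0.
have powRcont (t : R) : 0 < t -> {for t, continuous (fun t : R => t `^ p)}.
  move=> t0; apply: differentiable_continuous; apply/derivable1_diffP.
  by apply: ex_derive; exact: is_derive1_powR.
have kc : {within `[0, 1], continuous k}.
  apply/continuous_within_itvP => //; split.
  - move=> t t01; apply: differentiable_continuous; apply/derivable1_diffP.
    by have [] := kd t t01.
  - apply: cvgB; first by apply: cvg_at_right_filter; exact: gc.
    apply: cvgD; last by apply: cvgMr.
    by apply: cvg_at_right_filter; apply: cvgMr; exact: cvg_id.
  - apply: cvg_at_left_filter; apply: cvgB; first exact: gc.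
    apply: cvgD; first by apply: cvgMr; exact: cvg_id.
    by apply: cvgMr; exact: powRcont.
have [t t01 kE] := MVT ltr01 kd kc.
have : k 1 - k 0 <= 0.
  by rewrite kE subr0 mulr1 subr_le0 dgle//; move: t01; rewrite in_itv.
rewrite /k powR1 powR0 ?gt_eqF//; lra.
Qed.

Context {X : normedModType R}.
Implicit Types (F : X -> R^o) (x h : X).

Lemma diff_topological_dual F x : differentiable F x ->
  topological_dual ('d F x).
Proof. by move=> dF; split; [exact: linearP|exact: diff_continuous]. Qed.

Lemma topological_dualB (f g : X -> R^o) : topological_dual f ->
  topological_dual g -> topological_dual (fun v => f v - g v).
Proof.
move=> [fl fc] [gl gc]; split; last first.
  by move=> v; apply: cvgB; [exact: fc|exact: gc].
by move=> a u v; rewrite fl gl scalerBr opprD addrACA.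
Qed.

(** Along the segment the derivative in direction [h] exceeds its initial value by at most
    [L |t h|^(p - 1) |h| = L |h|^p t^(p - 1)], to which the previous bound applies. *)
Lemma holder_descent F x h p r L : 1 < p -> (forall y, differentiable F y) ->
  holder_diff_ball F (p - 1) r L ->
  (forall t, 0 <= t <= 1 -> `|x + t *: h| <= r) ->
  F (x + h) - F x <= 'd F x h + L * `|h| `^ p / p.
Proof.
move=> p1 dF FL seg.
have p0 : 0 < p by apply: lt_trans p1.
have := @derive_powR_bound (fun t => F (x + t *: h))
  (fun t => 'd F (x + t *: h) h) p ('d F x h) (L * `|h| `^ p) p1.
rewrite scale1r scale0r addr0; apply.
  by move=> t; exact: is_derive_line.
move=> t /andP[t0 t1].
have xr : `|x| <= r by have := seg 0; rewrite scale0r addr0 lexx ler01; exact.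
have xtr : `|x + t *: h| <= r by apply: seg; rewrite !ltW.
have dd := topological_dualB (diff_topological_dual (dF (x + t *: h)))
  (diff_topological_dual (dF x)).
rewrite -lerBlDl; apply: le_trans (ler_norm _) _.
apply: le_trans (dual_norm_le h dd) _.
apply: le_trans (ler_wpM2r _ (FL _ _ xtr xr)) _ => //.
rewrite [x + _ - x]addrAC subrr add0r normrZ gtr0_norm// powRM ?(ltW t0)//.
rewrite -(mulr_powRB1 (normr_ge0 h) p0) le_eqVlt.
by apply/orP; left; apply/eqP; ring.
Qed.

End HoelderDescent.

(** * Estimates for a single minimizer of the proximal subproblem *)

Section ForwardBackwardStep.
Context {R : realType} {X : normedModType R}.
Variables (F : X -> R^o) (Phi : X -> \bar R) (p tau : R).
Hypotheses (p_gt1 : 1 < p) (tau_gt0 : 0 < tau).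
Hypothesis F_diff : forall x, differentiable F x.
Hypothesis F_convex : convex_function setT F.
Hypothesis Phi_convex : convex_efunction Phi.
Variables (x v : X) (a b : R).
Hypotheses (Phi_x : Phi x = a%:E) (Phi_v : Phi v = b%:E).
Hypothesis v_min : minimizer (fb_objective F Phi p tau x) v.

Let p_gt0 : 0 < p. Proof. exact: lt_trans p_gt1. Qed.

Let decr : R := 'd F x (x - v) + a - b.

Lemma convex_efunction_fin y z (c d s : R) : 0 <= s <= 1 -> Phi y = c%:E ->
  Phi z = d%:E -> (Phi (z + s *: (y - z))%R <= (d + s * (c - d))%:E)%E.
Proof.
move=> /andP[s0 s1] Phiy Phiz; have := Phi_convex (Itv01 s0 s1) y z.
rewrite -[X in Phi X]/(s *: y + (1 - s) *: z).
have -> : s *: y + (1 - s) *: z = z + s *: (y - z).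
  by rewrite scalerBl scale1r scalerBr addrCA.
rewrite Phiy Phiz -[X in (_ <= X)%E]/((s * c + (1 - s) * d)%R%:E).
by have -> : s * c + (1 - s) * d = d + s * (c - d) by lra.
Qed.

(** Minimality of [v] against [z + s (y - z)], with [Phi] replaced by its chord. It serves twice:
    from [v] towards [x], and from [x] towards a minimizer of the energy. *)
Lemma fb_objective_le_conv y z (c d s : R) : 0 <= s <= 1 -> Phi y = c%:E ->
  Phi z = d%:E ->
  `|v - x| `^ p / p + tau * ('d F x v + b) <=
  `|z + s *: (y - z) - x| `^ p / p +
  tau * ('d F x z + s * 'd F x (y - z) + d + s * (c - d)).
Proof.
move=> s01 Phiy Phiz; rewrite -lee_fin.
have := v_min (z + s *: (y - z)); rewrite /fb_objective Phi_v -EFinD.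
move=> /le_trans; apply.
rewrite EFinD leeD2l// EFinM lee_wpmul2l ?lee_fin ?(ltW tau_gt0)//.
rewrite -addrA EFinD; apply: leeD; last exact: convex_efunction_fin.
by rewrite lee_fin linearD linearZ.
Qed.

(** Moving from [v] towards [x] by [s] gives [N (1 - (1 - s)^p) <= p s tau D] for [N = |v - x|^p];
    the Bernoulli-type bound turns this into [N <= tau D (1 + p s)], and [s] tends to 0. *)
Lemma fb_step_norm_le : `|v - x| `^ p <= tau * decr.
Proof.
have h (s : R) : 0 < s < 1 -> `|v - x| `^ p <= tau * decr * (1 + p * s).
  move=> /andP[s0 s1]; have s01 : 0 <= s <= 1 by rewrite !ltW.
  have := fb_objective_le_conv s01 Phi_x Phi_v.
  have -> : v + s *: (x - v) - x = (1 - s) *: (v - x).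
    by rewrite scalerBl scale1r -[x - v]opprB scalerN addrAC.
  have s1' : 0 <= 1 - s by rewrite subr_ge0 ltW.
  rewrite normrZ ger0_norm// powRM// => hh.
  have := @powR_onem_le _ p s (ltW p_gt0); rewrite s1 (ltW s0) => /(_ isT).
  have ps : 0 < 1 + p * s by rewrite ltr_pwDl// mulr_ge0 ?ltW.
  have := powR_ge0 `|v - x| p; move: hh; rewrite -/decr; set N := `|v - x| `^ p.
  set q := (1 - s) `^ p => hh N0 qle.
  have h1 : (N - q * N) <= p * s * (tau * decr).
    rewrite -(ler_pM2r (_ : 0 < p^-1)) ?invr_gt0//.
    have -> : p * s * (tau * decr) / p = s * (tau * decr).
      by field; rewrite gt_eqF.
    by move: hh; rewrite /decr; lra.
  have h2 : q * N * (1 + p * s) <= N.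
    rewrite -ler_pdivlMr// mulrC ler_wpM2l//.
  have h3 : N * (p * s) <= p * s * (tau * decr) * (1 + p * s).
    have := ler_wpM2r (ltW ps) h1; lra.
  by rewrite -(ler_pM2r (mulr_gt0 p_gt0 s0)); lra.
have t0 : 0 <= tau * decr.
  have h2 : 0 < (2^-1 : R) < 1 by apply/andP; split; lra.
  have := le_trans (powR_ge0 _ _) (h _ h2).
  by rewrite pmulr_lge0// ltr_pwDl// divr_ge0// ltW.
apply/ler_addgt0Pl => e e0.
have q0 : 0 < p * (tau * decr) + 1 by rewrite ltr_pwDr// mulr_ge0// ltW.
(* This makes the excess [tau * decr * p * s] at most [e]; the added 1 keeps the denominator
   positive when [decr = 0]. *)
pose s := Num.min (e / (p * (tau * decr) + 1)) 2^-1.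
have s0 : 0 < s by rewrite lt_min divr_gt0//= invr_gt0.
have s1 : s < 1 by rewrite gt_min [2^-1 < 1](_ : _ = true) ?orbT//; lra.
have : s <= e / (p * (tau * decr) + 1) by rewrite ge_min lexx.
rewrite ler_pdivlMr// => se.
have := h s; rewrite s0 s1 => /(_ isT); lra.
Qed.

Lemma fb_step_decr_ge0 : 0 <= decr.
Proof.
by have := le_trans (powR_ge0 _ _) fb_step_norm_le; rewrite pmulr_rge0.
Qed.

(** The upper bound on the step size is what makes the Hoelder remainder consume at most the share
    [1 - delta] of [decr]. *)
Lemma fb_step_holder_le (L delta : R) : 0 < L -> tau <= p * (1 - delta) / L ->
  L * `|v - x| `^ p / p <= (1 - delta) * decr.
Proof.
move=> L0 tauL; rewrite ler_pdivrMr//.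
apply: le_trans (ler_wpM2l (ltW L0) fb_step_norm_le) _.
rewrite mulrA [leRHS]mulrAC ler_wpM2r ?fb_step_decr_ge0//.
by move: tauL; rewrite ler_pdivlMr//; lra.
Qed.

Lemma fb_step_descent (r L delta : R) : 0 < L -> delta < 1 ->
  tau <= p * (1 - delta) / L -> holder_diff_ball F (p - 1) r L ->
  (forall t : R, 0 <= t <= 1 -> `|x + t *: (v - x)| <= r) ->
  F v + b <= F x + a - delta * decr.
Proof.
move=> L0 d1 tauL FL seg.
have := holder_descent p_gt1 F_diff FL seg; rewrite [x + _]addrC subrK => Fv.
have LD := fb_step_holder_le L0 tauL.
have : 'd F x (v - x) = - 'd F x (x - v) by rewrite -linearN opprB.
rewrite /decr in LD *; lra.
Qed.

Lemma segment_ball (r t : R) (y z : X) :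
  `|y| <= r -> `|z| <= r -> 0 <= t <= 1 ->
  `|y + t *: (z - y)| <= r.
Proof.
move=> yr zr /andP[t0 t1].
have -> : y + t *: (z - y) = (1 - t) *: y + t *: z.
  by rewrite scalerBl scale1r scalerBr addrA addrAC.
apply: le_trans (ler_normD _ _) _.
rewrite !normrZ (ger0_norm t0) ger0_norm ?subr_ge0//.
have t1' : 0 <= 1 - t by rewrite subr_ge0.
have := ler_wpM2l t0 zr; have := ler_wpM2l t1' yr; lra.
Qed.

(* The segment from [x] to [v] stays in the sublevel set of [x]: its energy is
   bounded by the convex function [g], which starts decreasing, and at a return
   to [g 0] the descent estimate on the part already travelled would give a
   strictly smaller value. *)
Lemma fb_step_sublevel (r L delta : R) : 0 < L -> 0 < delta -> delta < 1 ->
  tau <= p * (1 - delta) / L -> holder_diff_ball F (p - 1) r L ->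
  (forall y, (energy F Phi y <= energy F Phi x)%E -> `|y| <= r) ->
  forall t : R, 0 <= t <= 1 -> `|x + t *: (v - x)| <= r.
Proof.
move=> L0 d0 d1 tauL FL xr.
pose g (t : R) :=  F (x + t *: (v - x)) - F x + t * (b - a).
have g_ball t : 0 <= t <= 1 -> g t <= 0 -> `|x + t *: (v - x)| <= r.
  move=> t01 gt; apply: xr; rewrite /energy Phi_x.
  apply: le_trans (leeD2l _ (convex_efunction_fin t01 Phi_v Phi_x)) _.
  rewrite -!EFinD lee_fin; move: gt; rewrite /g; lra.
have g_conv s t : 0 <= s <= 1 -> g (s * t) <= s * g t.
  move=> /andP[s0 s1].
  have := F_convex (Itv01 s0 s1) (in_setT (x + t *: (v - x))) (in_setT x).
  rewrite -[X in F X <= _]/(s *: (x + t *: (v - x)) + (1 - s) *: x).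
  rewrite -[X in _ <= X]/(s * F (x + t *: (v - x)) + (1 - s) * F x).
  have -> : s *: (x + t *: (v - x)) + (1 - s) *: x = x + (s * t) *: (v - x).
    by rewrite scalerDr scalerBl scale1r scalerA addrC addrA subrK.
  rewrite /g; lra.
suff g1 : g 1 <= 0.
  move=> t t01; apply: g_ball => //.
  have := g_conv t 1 t01; rewrite mulr1 => /le_trans; apply.
  by apply: mulr_ge0_le0 => //; case/andP: t01.
(* For [v = x] the function [g] vanishes; otherwise [decr > 0], so [g] starts with the negative
   slope [- decr]. *)
have [vx|vx] := eqVneq v x.
  move: Phi_v; rewrite /g vx Phi_x => -[->].
  by rewrite subrr scaler0 addr0 !subrr mulr0 addr0.
have N0 : 0 < `|v - x| `^ p by rewrite powR_gt0// normr_gt0 subr_eq0.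
have decr0 : 0 < decr.
  by rewrite -(pmulr_rgt0 _ tau_gt0); apply: lt_le_trans fb_step_norm_le.
rewrite leNgt; apply/negP => g1.
have dE : 'd F x (v - x) = - 'd F x (x - v) by rewrite -linearN opprB.
have dlt : 'd F x (v - x) < a - b by rewrite dE; rewrite /decr in decr0; lra.
have [t0 /andP[t00 t01] Ft0] := exists_lt_diff (F_diff x) dlt.
have gt0 : g t0 < 0 by rewrite /g; lra.
have gc t : {for t, continuous g}.
  apply: differentiable_continuous; apply/derivable1_diffP.
  have := is_derive_line (F_diff (x + t *: (v - x))) => Fl.
  by apply: derivableD; [apply: derivableB => //|].
have [T] : exists2 T, T \in `[t0, 1] & g T = 0.
  apply: IVT; first exact: ltW.
    by apply: continuous_subspaceT => t; exact: gc.
  by rewrite ge_min (ltW gt0)/= le_max (ltW g1) orbT.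
rewrite in_itv/= => /andP[t0T T1] gT.
have T0 : 0 < T by apply: lt_le_trans t0T.
(* Convexity with [g 0 = g T = 0] keeps [g] nonpositive up to [T], so the Hoelder constant is valid
   on this part. *)
have seg t : 0 <= t <= 1 -> `|x + t *: (T *: (v - x))| <= r.
  move=> /[dup] t01' /andP[t0' t1']; rewrite scalerA; apply: g_ball.
    apply/andP; split; first by rewrite mulr_ge0// ltW.
    by rewrite mulr_ile1// ltW.
  by have := g_conv t T t01'; rewrite gT mulr0.
have := holder_descent p_gt1 F_diff FL seg.
rewrite normrZ gtr0_norm// powRM ?(ltW T0)// linearZ/=.
have LD := fb_step_holder_le L0 tauL.
(* The remainder scales with [T^p <= T], so the descent estimate gives
   [g T <= - T * delta * decr < 0], contradicting [g T = 0]. *)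
have Tp : T `^ p <= T by apply: ge1r_powR; rewrite ?T0 ?T1// ltW.
have LN0 : 0 <= L * `|v - x| `^ p / p.
  by rewrite !mulr_ge0 ?invr_ge0 ?powR_ge0// ltW.
have := ler_wpM2r LN0 Tp; have := ler_wpM2l (ltW T0) LD.
have : 0 < T * (delta * decr) by rewrite !mulr_gt0.
move: gT; rewrite /g dE /decr -[T *: - _]/(T * - _); lra.
Qed.

(** Compare [v] with [x + s (y - x)], drop the proximal term of [v], bound [F'(x)] at [y - x] by the
    gradient inequality, and divide by [tau]. *)
Lemma fb_step_decr_ge y (c K s : R) : Phi y = c%:E ->
  `|y - x| `^ p <= K -> 0 <= s <= 1 ->
  s * (F x + a - (F y + c)) - s `^ p * (K / (p * tau)) <= decr.
Proof.
move=> Phiy yK s01; have := fb_objective_le_conv s01 Phiy Phi_x.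
have := convex_gradient_le y F_convex (F_diff x).
have s0 : 0 <= s by case/andP: s01.
rewrite [x + _ - x]addrAC subrr add0r normrZ ger0_norm// powRM//.
have := powR_ge0 `|v - x| p; set N := _ `^ p => N0 gr.
have : s `^ p * `|y - x| `^ p <= s `^ p * K by rewrite ler_wpM2l// powR_ge0.
set M := s `^ p * _ => MK le1.
have -> : s `^ p * (K / (p * tau)) = s `^ p * K / p / tau.
  by rewrite invfM !mulrA.
rewrite -(ler_pM2l tau_gt0) mulrBr [tau * (_ / tau)]mulrC divfK ?gt_eqF//.
have Mp : M / p <= s `^ p * K / p by rewrite ler_pM2r ?invr_gt0.
have Np : 0 <= N / p by rewrite divr_ge0// ltW.
have sg := ler_wpM2l s0 gr; have tsg := ler_wpM2l (ltW tau_gt0) sg.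
have dB : 'd F x (x - v) = 'd F x x - 'd F x v by rewrite linearB.
rewrite /decr dB; lra.
Qed.

End ForwardBackwardStep.

(** * The rate of convergence *)

Lemma powRN_cvg0 (R : realType) (q : R) : 0 < q ->
  n.+1%:R `^ (- q) @[n --> \oo] --> (0 : R).
Proof.
move=> q0; have /cvg_at_rightP/(_ (fun n => n.+1%:R^-1)) := powR_cvg0 q0.
have h : (forall n, 0 < n.+1%:R^-1 :> R) /\ n.+1%:R^-1 @[n --> \oo] --> (0 : R).
  by split; [move=> n; rewrite invr_gt0|exact: cvg_harmonic].
move=> /(_ h); apply: cvg_trans; apply: near_eq_cvg; near=> n.
by rewrite -powR_inv1// -powRrM mulN1r.
Unshelve. all: by end_near. Qed.

Theorem proposition4 (R : realType) (X : completeNormedModType R)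
    (X_reflexive : reflexive_space X)
    (F : X -> R^o) (Phi : X -> \bar R) (p : R)
    (p_gt1 : 1 < p) (p_le2 : p <= 2)
    (F_proper : proper_efunction (fun x : X => (F x)%:E))
    (F_convex : convex_function setT F)
    (F_lsc : lower_semicontinuous (fun x : X => (F x)%:E))
    (Phi_proper : proper_efunction Phi)
    (Phi_convex : convex_efunction Phi)
    (Phi_lsc : lower_semicontinuous Phi)
    (F_diff : forall x : X, differentiable F x)
    (F_holder : forall r : R, 0 < r ->
       exists2 L : R, 0 < L & holder_diff_ball F (p - 1) r L)
    (delta taumin : R) (delta_gt0 : 0 < delta) (delta_lt1 : delta < 1)
    (taumin_gt0 : 0 < taumin)
    (u : nat -> X) (L tau : nat -> R)
    (Phi_u0 : (Phi (u 0%N) < +oo)%E)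
    (L_gt0 : forall n : nat, 0 < L n)
    (tau_bounds : forall n : nat,
       taumin <= tau n /\ tau n <= p * (1 - delta) / L n)
    (u_step : forall n : nat, fb_step F Phi p (tau n) (u n) (u n.+1))
    (coercive_or_bounded :
       (coercive (energy F Phi) /\
        (forall n : nat, exists r : R,
           (forall x : X, (energy F Phi x <= energy F Phi (u n))%E ->
              `|x| <= r) /\
           holder_diff_ball F (p - 1) r (L n)))
       \/
       (bounded_fun u /\ (exists x : X, minimizer (energy F Phi) x) /\
        (forall n : nat, exists r : R,
           (forall k : nat, `|u k| <= r) /\
           holder_diff_ball F (p - 1) r (L n)))) :
  exists2 umin : X, minimizer (energy F Phi) umin &
    (energy F Phi (u n) @[n --> \oo] --> energy F Phi umin) /\
    (exists2 C : R, 0 < C & forall n : nat, (1 <= n)%N ->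
       (energy F Phi (u n) - energy F Phi umin
          <= (C * n%:R `^ (1 - p))%:E)%E).
Proof.
have tau_gt0 n : 0 < tau n by case: (tau_bounds n) => + _; apply: lt_le_trans.
have p_gt0 : 0 < p by apply: lt_trans p_gt1.
have PhiNy := Phi_proper.1.
have Phi_fin x : (Phi x < +oo)%E -> Phi x = (fine (Phi x))%:E.
  by move=> xy; rewrite fineK// fin_numElt PhiNy.
(* Finiteness propagates because the objective at [u n.+1] is at most its finite value at [u n]. *)
have Phi_u n : Phi (u n) = (fine (Phi (u n)))%:E.
  elim: n => [|n IH]; first exact: Phi_fin.
  apply: Phi_fin; have := (u_step n).1 (u n).
  rewrite /fb_objective IH -!EFinD => /le_lt_trans/(_ (ltry _)).
  case: (Phi (u n.+1)) => [s _||_]//; rewrite ?ltry//.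
  by rewrite addey// mulry gtr0_sg// mul1e.
set a := fun n => fine (Phi (u n)) in Phi_u.
pose e n := F (u n) + a n.
have eE n : energy F Phi (u n) = (e n)%:E by rewrite /energy Phi_u.
have [umin uminP] : exists x, minimizer (energy F Phi) x.
  case: coercive_or_bounded => [[Eco _]|[_ [//]]].
  apply: coercive_has_minimizer => //.
  - by exists (u 0%N); rewrite eE ltry.
  - exact: energy_convex.
  - exact: energy_lsc.
have [c Phi_umin] : exists c, Phi umin = c%:E.
  exists (fine (Phi umin)); apply: Phi_fin.
  have := uminP (u 0%N); rewrite eE => /le_lt_trans/(_ (ltry _)).
  by rewrite /energy; case: (Phi umin) => [s _||_]//; rewrite ltry.
pose A n := 'd F (u n) (u n - u n.+1) + a n - a n.+1.
have A_ge0 n : 0 <= A n.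
  exact: (fb_step_decr_ge0 p_gt1 (tau_gt0 n) Phi_convex (Phi_u n) (Phi_u n.+1)
    (u_step n).1).
have e_descent n : e n.+1 <= e n - delta * A n.
  (* In the coercive case the segment stays in the sublevel set of [u n]; in the bounded case the
     ball contains both endpoints and is convex. *)
  have [r [FL seg]] : exists r, holder_diff_ball F (p - 1) r (L n) /\
      forall t : R, 0 <= t <= 1 -> `|u n + t *: (u n.+1 - u n)| <= r.
    case: coercive_or_bounded =>
      [[_ /(_ n)[r [ur FL]]]|[_ [_ /(_ n)[r [ur FL]]]]];
      exists r; split=> // t t01.
      apply: (fb_step_sublevel p_gt1 (tau_gt0 n) F_diff F_convex Phi_convex
        (Phi_u n) (Phi_u n.+1) (u_step n).1 (L_gt0 n) delta_gt0 delta_lt1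
        (tau_bounds n).2 FL ur t01).
    exact: segment_ball.
  exact: (fb_step_descent p_gt1 (tau_gt0 n) F_diff Phi_convex
    (Phi_u n) (Phi_u n.+1) (u_step n).1 (L_gt0 n) delta_lt1
    (tau_bounds n).2 FL seg).
have e_le n : e n <= e 0%N.
  elim: n => // n; apply: le_trans; apply: le_trans (e_descent n) _.
  by rewrite gerBl mulr_ge0// ltW.
(* In the coercive case all iterates lie in the sublevel set of [u 0], as the energies decrease. *)
have [M uM] : exists M, forall n, `|u n| <= M.
  case: coercive_or_bounded =>
    [[_ /(_ 0%N)[r [ur _]]]|[_ [_ /(_ 0%N)[r [ur _]]]]].
    by exists r => n; apply: ur; rewrite !eE lee_fin.
  by exists r.
pose K := (`|umin| + M) `^ p + 1.
have K_gt0 : 0 < K by rewrite ltr_wpDl// powR_ge0.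
have uK n : `|umin - u n| `^ p <= K.
  have h : `|umin - u n| <= `|umin| + M.
    by apply: le_trans (ler_normB _ _) _; rewrite lerD2l.
  have : `|umin - u n| `^ p <= (`|umin| + M) `^ p.
    by apply: ge0_ler_powR; rewrite ?nnegrE ?(ltW p_gt0)// (le_trans _ h).
  by move=> /le_trans; apply; rewrite lerDl.
pose r n := e n - (F umin + c).
have r_ge0 n : 0 <= r n.
  rewrite subr_ge0 -lee_fin -eE; apply: le_trans (uminP (u n)).
  by rewrite /energy Phi_umin.
(* Since [taumin <= tau n], the constant [K / (p * taumin)] dominates every [K / (p * tau n)]. *)
have [||n s s01|C C_gt0 rC] := @descent_rate _ p delta (K / (p * taumin)) r A
  p_gt1 p_le2 delta_gt0 _ r_ge0.
- by rewrite divr_gt0// mulr_gt0.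
- by move=> n; rewrite /r; have := e_descent n; lra.
- apply: le_trans (fb_step_decr_ge p_gt1 (tau_gt0 n) F_diff F_convex Phi_convex
    (Phi_u n) (Phi_u n.+1) (u_step n).1 Phi_umin (uK n) s01).
  rewrite lerD2l lerN2 ler_wpM2l ?powR_ge0// ler_pM2l//.
  rewrite lef_pV2 ?posrE ?mulr_gt0// ler_pM2l//; exact: (tau_bounds n).1.
have rE n : (energy F Phi (u n) - energy F Phi umin)%E = (r n)%:E.
  by rewrite eE /energy Phi_umin.
exists umin => //; split; last first.
  by exists C => // n n1; rewrite rE lee_fin rC.
have r_cvg0 : r n @[n --> \oo] --> 0.
  rewrite -cvg_shiftS; apply: (@squeeze_cvgr _ _ _ _ (fun=> 0)
    (fun n => C * n.+1%:R `^ (- (p - 1)))).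
  - by apply: nearW => n; rewrite r_ge0 opprB rC.
  - exact: cvg_cst.
  - rewrite -(mulr0 C); apply: cvgMr; apply: powRN_cvg0; rewrite subr_gt0//.
have -> : energy F Phi umin = (F umin + c)%:E by rewrite /energy Phi_umin.
have -> : (fun n => energy F Phi (u n)) = (fun n => (r n + (F umin + c))%:E).
  by apply/funext => n; rewrite eE subrK.
apply: cvg_EFin; first by apply: nearW.
rewrite -[X in _ --> X]add0r; apply: cvgD => //; exact: cvg_cst.
Qed.
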